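(* For every $\varepsilon>0$ there is an integer $N$ such that for all $n\ge N$ and all cycles $A_n$ with node set $[n]$, if $B_n$ is drawn uniformly at random from all cycles with node set $[n]$, then $$\Pr\bigl(G^{AB}_n \text{ is connected}\bigr)\ \ge\ 1-\varepsilon .$$
   Context: For $m\ge 3$, a cycle on $[m]=\{1,\dots,m\}$ is an undirected Hamiltonian cycle with node set $[m]$; its edges are called cycle-edges. A cycle $A_n$ on $[n]$ determines cycles $A_3,\dots,A_{n-1}$, where $A_{m-1}$ is obtained from $A_m$ by deleting node $m$ and joining its two neighbours by a cycle-edge; thus $A_m$ arises from $A_{m-1}$ by inserting node $m$ into (subdividing) a cycle-edge of $A_{m-1}$, and $A_3$ is the unique cycle on $\{1,2,3\}$. For $4\le m\le n$ let $\nu_A(m)$ be the set of the two neighbours of $m$ in $A_m$ (the cycle-edge of $A_{m-1}$ into which $m$ was inserted); set $\nu_A(3)=\{1,2\}$, $\nu_A(2)=\{1\}$, $\nu_A(1)=\emptyset$. Define $B_m$ and $\nu_B$ in the same way from $B_n$. The pedigree graph $G^{AB}_n$ has vertex set $\{m\in\{4,\dots,n\}:\nu_A(m)\neq\nu_B(m)\}$, and for vertices $k<m$ of it, $\{k,m\}$ is an edge iff at least one of the following holds: (i) $\nu_A(m)=\nu_B(k)$; (ii) $\nu_B(m)=\nu_A(k)$; (iii) $k=\max\nu_A(m)$ and $\nu_B(k)\cap\nu_A(m)=\emptyset$; (iv) $k=\max\nu_B(m)$ and $\nu_A(k)\cap\nu_B(m)=\emptyset$. *)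

(* Defs.v *)
From HB Require Import structures.
From mathcomp Require Import all_boot all_order all_algebra.
From mathcomp Require Import reals.

Set Implicit Arguments.
Unset Strict Implicit.
Unset Printing Implicit Defensive.

Import Order.TTheory GRing.Theory Num.Theory.
Local Open Scope ring_scope.

(* Nodes 1, ..., n live in 'I_n.+1; the element 0 is never a node.            *)
(* An undirected graph is identified with its set of edges.                   *)
Notation edges n := {set {set 'I_n.+1}}.

Definition cyclic_edges (T : finType) (s : seq T) : {set {set T}} :=
  [set [set x; next s x] | x in s].

Definition cycles (n : nat) : {set edges n} :=
  [set E | (3 <= n)%N &&
    [exists s : n.-tuple 'I_n.+1,
      [&& uniq s, [set x in s] == [set x : 'I_n.+1 | (1 <= x)%N]
        & E == cyclic_edges s]]].

Definition neighbours (T : finType) (E : {set {set T}}) (v : T) : {set T} :=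
  [set u | [set v; u] \in E].

(* In a cycle of length at least 4, [neighbours E v] is a pair of nodes, hence *)
(* itself the edge that joins the two neighbours of the deleted node v.       *)
Definition delete_node (T : finType) (v : T) (E : {set {set T}}) :
    {set {set T}} :=
  neighbours E v |: [set e in E | v \notin e].

(* The cycle A_m determined by A = A_n, for 3 <= m <= n: [foldr] deletes n    *)
(* first, then n - 1, and so on down to m + 1.                                *)
Definition subcycle (n : nat) (A : edges n) (m : nat) : edges n :=
  foldr (fun k E => delete_node (inord k) E) A (iota m.+1 (n - m)%N).

(* The second branch gives {1, 2}, {1}, set0 at 3, 2, 1.                      *)
Definition nu (n : nat) (A : edges n) (m : 'I_n.+1) : {set 'I_n.+1} :=
  if (4 <= m)%N then neighbours (subcycle A m) m
  else [set u : 'I_n.+1 | (1 <= u < m)%N].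

Definition pedigree_vertices (n : nat) (A B : edges n) : {set 'I_n.+1} :=
  [set m : 'I_n.+1 | (4 <= m)%N && (nu A m != nu B m)].

(* Only meant for k < m. *)
Definition pedigree_adj (n : nat) (A B : edges n) (k m : 'I_n.+1) : bool :=
  [|| nu A m == nu B k,
      nu B m == nu A k,
      ((k : nat) == (\max_(u in nu A m) u)%N) && (nu B k :&: nu A m == set0)
    | ((k : nat) == (\max_(u in nu B m) u)%N) && (nu A k :&: nu B m == set0)].

Definition pedigree_edge (n : nat) (A B : edges n) : rel 'I_n.+1 :=
  [rel x y | [&& x \in pedigree_vertices A B, y \in pedigree_vertices A B
    & ((x < y)%N && pedigree_adj A B x y) || ((y < x)%N && pedigree_adj A B y x)]].

(* The graph with no vertices is not considered connected. *)
Definition connected_graph (T : finType) (V : {set T}) (e : rel T) : bool :=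
  (V != set0) && [forall x in V, forall y in V, connect e x y].

Definition pedigree_connected (n : nat) (A B : edges n) : bool :=
  connected_graph (pedigree_vertices A B) (pedigree_edge A B).

Definition uniform_prob (R : realType) (T : finType) (S : {set T})
    (P : pred T) : R :=
  #|[set x in S | P x]|%:R / #|S|%:R.

(* Main.v *)
Require Import Defs.
From mathcomp Require Import all_boot all_order all_algebra.
From mathcomp Require Import reals.
From mathcomp Require Import zify ring lra.

(* Build A and B one node at a time; given B_m, the insertion edge q of node    *)
(* m + 1 in B is uniform over the m edges of B_m, while that of A, called p, is *)
(* fixed. If p is not an edge of B_m, then m + 1 is joined to an old vertex     *)
(* determined by p and B_m, and every other component of the graph owns an edge *)
(* of B_m that merges it when chosen as q. If p is an edge of B_m, then A uses  *)
(* up a common edge, and a new component appears only if q is another common    *)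
(* edge. Let Y be the number of components minus one, W = Y + the number of     *)
(* common edges, I the indicator of p in B_m and g = |p :&: q|, whose        *)
(* values sum to 4 over q. Then W' + I <= W + g, and the sum of Y' over q is at *)
(* most (m - 1) Y + I W. In the potential 2 (m - 1) Y + W^2 + W at level m, the *)
(* square absorbs the error I W, so its mean grows by at most (8 W + 12) / m.   *)
(* Hence E[W] = O(log n) and E[Y] = O((log n)^2 / n).                           *)

(** Two structural facts carry the argument. By [exists_target], every edge of one cycle that is
    missing from the other points to an earlier vertex of the graph; so a new node can start a
    component only when both of its insertion edges are common. By [component_edge], every component
    owns an edge of [Q] outside [P] that points only into it. So, when [p] is not in [Q], each
    component other than the one joined through [p] is merged by some choice of [q], which gives
    [sum_excess_insert].

    With [weight_insert] this yields the drift bound [sum_potential_insert] for a fixed pair of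
    cycles. It can be summed over all cycles because a uniform cycle on m + 1 nodes is a uniform
    cycle on m nodes with a uniform edge subdivided ([sum_cycles]).

    A disconnected nonempty graph has excess at least 1, hence potential at least 2 (n - 1), and
    Markov's inequality bounds its probability by O((log n)^2 / n). An empty graph forces the last
    insertion edges to agree, which has probability at most 1 / (n - 1). *)

Set Implicit Arguments.
Unset Strict Implicit.
Unset Printing Implicit Defensive.

Import Order.TTheory GRing.Theory Num.Theory.

(** * Inserting and deleting a node of a cyclic sequence *)

Section CyclicEdges.
Variable T : finType.
Implicit Types (x y v : T) (p s : seq T) (e : {set T}) (E : {set {set T}}).

Definition insert_node v e E : {set {set T}} :=
  [set [set v; y] | y in e] :|: (E :\ e).

Definition path_edges x p : seq {set T} := pairmap (fun u w => [set u; w]) x p.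

Lemma cyclic_edges_cons x p : uniq (x :: p) ->
  cyclic_edges (x :: p) = [set last x p; x] |: [set e in path_edges x p].
Proof.
move=> Us; have -> : cyclic_edges (x :: p) = [set e in path_edges x (rcons p x)].
  have -> : path_edges x (rcons p x) =
      [seq [set y; next (x :: p) y] | y <- x :: p].
    apply: (@eq_from_nth _ set0) => [|i]; rewrite size_pairmap size_rcons.
      by rewrite size_map.
    move=> lti; rewrite (nth_pairmap x) ?size_rcons// -rcons_cons.
    rewrite !nth_rcons_default (nth_map x)//.
    by rewrite next_nth mem_nth// index_uniq.
  apply/setP=> e; rewrite inE; apply/imsetP/mapP => -[y ys ->]; exists y => //.
rewrite -cats1 /path_edges pairmap_cat /=.
by apply/setP=> e; rewrite !inE mem_cat inE orbC.
Qed.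

Lemma cyclic_edges_rot k s : uniq s -> cyclic_edges (rot k s) = cyclic_edges s.
Proof.
move=> Us; apply/setP=> e; apply/imsetP/imsetP => -[y ys ->]; exists y;
  by rewrite ?next_rot// ?mem_rot// -(mem_rot k).
Qed.

Lemma mem_path_edges x p e u : e \in path_edges x p -> u \in e -> u \in x :: p.
Proof.
elim: p x => //= y p IH x; rewrite inE => /orP[/eqP->|/IH{}IH /IH].
  by rewrite !inE => /orP[]->; rewrite ?orbT.
by move=> uyp; rewrite in_cons uyp orbT.
Qed.

Lemma set2_eq (u v w : T) : ([set v; u] == [set v; w]) = (u == w).
Proof.
apply/eqP/eqP => [/setP eq|->//].
move: (eq u) (eq w); rewrite !inE !eqxx !orbT => /esym/orP[/eqP uv|/eqP//].
by move=> /orP[/eqP->|/eqP->].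
Qed.

(** Every insertion or deletion reduces to this case by rotating the node to the front. The bound on
    [size p] leaves at least three nodes after the deletion, so that the closing edge [e] is not
    already an edge of the path. *)
Lemma insert_node_cyclic v x p : uniq (v :: x :: p) -> 1 < size p ->
  let E := cyclic_edges (v :: x :: p) in let E' := cyclic_edges (x :: p) in
  let e := [set x; last x p] in
  [/\ neighbours E v = e, delete_node v E = E', e \in E' & insert_node v e E' = E].
Proof.
move=> U sp E E' e.
have /andP[vxp Uxp] := U.
have vN f : f \in path_edges x p -> v \notin f.
  by move=> fp; apply: contra vxp => /(mem_path_edges fp).
have EE : E = [set v; last x p] |: ([set v; x] |: [set e in path_edges x p]).
  rewrite /E cyclic_edges_cons //= [[set last x p; v]]setUC.
  by congr setU; apply/setP=> f; rewrite !inE.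
have EE' : E' = e |: [set e in path_edges x p].
  by rewrite /E' cyclic_edges_cons // setUC [RHS]setUC [e]setUC.
have nE : neighbours E v = e.
  apply/setP=> u; rewrite inE EE !inE !set2_eq orbA orbC.
  have -> : [set v; u] \in path_edges x p = false.
    by apply/negbTE; apply: contraL (set21 v u) => /vN.
  by rewrite orbC /= orbF orbC.
split => //.
- rewrite /delete_node nE EE'; congr (_ |: _); apply/setP=> f; rewrite !inE EE !inE.
  apply/andP/idP => [[]|fp]; last by rewrite fp !orbT vN.
  by case/or3P => [/eqP->|/eqP->|//]; rewrite set21.
- by rewrite EE' setU11.
- rewrite /insert_node EE' EE setU1K; last first.
    rewrite inE /e; case: p sp U Uxp {vxp vN EE EE' nE E E' e} => //= y p sp U Uxp.
    rewrite inE negb_or set2_eq; apply/andP; split.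
      case: p sp U Uxp => //= z p _ U /and3P[_ + _].
      by apply: contraNN => /eqP <-; rewrite mem_last.
    case/andP: Uxp => xp _; apply: contra xp => /mem_path_edges; apply.
    by rewrite set21.
  by rewrite /e imsetU1 imset_set1 [RHS]setUA; congr setU; rewrite setUC.
Qed.
End CyclicEdges.

(** * Cycles on the first m nodes, and uniqueness for m = 3 *)

Section Cycles.
Variable n : nat.
Local Notation T := 'I_n.+1.
Implicit Types (m : nat) (E P Q : edges n) (e : {set T}).

Definition cycles_upto m : {set edges n} :=
  [set E | [exists s : m.-tuple T,
    [&& uniq s, [set x in s] == [set x : T | 1 <= x <= m]
      & E == cyclic_edges s]]].

Lemma cycles_uptoP m E :
  reflect (exists s : seq T, [/\ size s = m, uniq s,
             forall x : T, (x \in s) = (1 <= x <= m) & E = cyclic_edges s])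
    (E \in cycles_upto m).
Proof.
rewrite inE; apply: (iffP existsP) => [[s /and3P[Us /eqP Es /eqP ->]]|[s [ss Us Es ->]]].
  exists s; split; rewrite ?size_tuple// => x.
  by have /setP/(_ x) := Es; rewrite !inE.
have ss' : size s == m by apply/eqP.
exists (Tuple ss'); rewrite /= Us eqxx andbT /=.
by apply/eqP/setP=> x; rewrite !inE.
Qed.

Lemma cycles_uptoE : 2 < n -> cycles n = cycles_upto n.
Proof.
move=> n2; apply/setP=> E; rewrite !inE n2 /=; apply: eq_existsb => s.
congr [&& _, _ == _ & _]; apply/setP=> x.
by rewrite !inE leq_ord andbT.
Qed.

Local Notation node m := (inord m : T).

Lemma val_node m : m <= n -> node m = m :> nat.
Proof. by move=> mn; rewrite inordK. Qed.

Lemma insert_cycle m E e : 2 < m < n -> E \in cycles_upto m -> e \in E ->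
  let E1 := insert_node (node m.+1) e E in
  [/\ E1 \in cycles_upto m.+1, neighbours E1 (node m.+1) = e
    & delete_node (node m.+1) E1 = E].
Proof.
case/andP=> m2 mn /cycles_uptoP[s [ss Us Es ->]] /imsetP[y ys eE].
have [i p' rE] := rot_to ys.
have sp' : size (y :: p') = m by rewrite -rE size_rot.
case: p' => [|x p] in rE sp'; first by rewrite -sp' in m2.
(* Now [y] is last and its successor [x] first, so [e] is the closing edge. *)
have rE' : rot 1 (rot i s) = x :: rcons p y by rewrite rE rot1_cons.
have Ur : uniq (x :: rcons p y) by rewrite -rE' !rot_uniq.
have memr z : (z \in x :: rcons p y) = (1 <= z <= m) by rewrite -rE' !mem_rot Es.
rewrite -(cyclic_edges_rot i)// -(cyclic_edges_rot 1) ?rot_uniq// rE'.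
have {}eE : e = [set x; last x (rcons p y)].
  by rewrite eE -(next_rot i)// rE /= eqxx last_rcons setUC.
have vn : node m.+1 \notin x :: rcons p y by rewrite memr val_node// ltnn andbF.
have [| | nE dE eE' iE] := @insert_node_cyclic _ (node m.+1) x (rcons p y).
- by rewrite cons_uniq vn.
- by rewrite size_rcons ltnS; case: (p) sp' m2 => // <-.
rewrite /= eE iE; split=> //.
apply/cycles_uptoP; exists (node m.+1 :: x :: rcons p y); split=> //.
- by rewrite /= size_rcons -sp'.
- by rewrite cons_uniq vn.
- move=> z; rewrite inE memr -val_eqE /= val_node// [z <= m.+1]leq_eqVlt ltnS.
  by case: eqP => [->|].
Qed.

Lemma delete_cycle m E : 2 < m < n -> E \in cycles_upto m.+1 ->
  let v := node m.+1 in
  [/\ delete_node v E \in cycles_upto m, neighbours E v \in delete_node v E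
    & insert_node v (neighbours E v) (delete_node v E) = E].
Proof.
case/andP=> m2 mn /cycles_uptoP[s [ss Us Es ->]] v.
have vs : v \in s by rewrite Es val_node// leqnn.
have [i p' rE] := rot_to vs.
rewrite -(cyclic_edges_rot i)// rE.
have sp' : size (v :: p') = m.+1 by rewrite -rE size_rot.
case: p' rE sp' => [|x p] rE sp'; first by case: sp' m2 => <-.
have Ur : uniq (v :: x :: p) by rewrite -rE rot_uniq.
have [||-> -> -> ->] := @insert_node_cyclic _ v x p => //.
  by case: sp' m2 => <-.
split=> //; apply/cycles_uptoP; exists (x :: p); split=> //.
- by case: sp'.
- by case/andP: Ur.
move=> z; have /andP[vN _] := Ur.
have := Es z; rewrite -(mem_rot i) rE inE -val_eqE /= val_node//.
case: eqP => [zm _|zm /= ->].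
  by rewrite zm ltnn andbF; apply/negbTE; apply: contra vN;
    rewrite (_ : z = v)//; apply/val_inj; rewrite /= val_node.
by rewrite [z <= m.+1]leq_eqVlt ltnS; case: eqP zm.
Qed.

(** On three nodes every pair is an edge. The right-hand side no longer depends on the order of the
    nodes, whence [cycle3_eq]. *)
Lemma triangle (a b c : T) e : uniq [:: a; b; c] ->
  (e \in [set [set a; b]; [set b; c]; [set c; a]]) =
  (#|e| == 2) && (e \subset [set a; b; c]).
Proof.
rewrite /= !inE negb_or andbT => /andP[/andP[ab ac] bc].
apply/idP/andP => [|[/cards2P[u [v [uv ->]]]]].
  move=> /orP[/orP[]|] /eqP->; rewrite cards2 ?ab ?bc ?(eq_sym c a) ?ac /=; split=> //;
  by apply/subsetP=> z; rewrite !inE => /orP[]->; rewrite ?orbT.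
move=> /subsetP sub.
have := sub u; have := sub v; rewrite !inE !eqxx ?orbT => /(_ isT) + /(_ isT).
move=> vs us; move: uv.
case/orP: vs => [/orP[]|] /eqP->; case/orP: us => [/orP[]|] /eqP->;
  by [rewrite eqxx | move=> _; rewrite eqxx ?orbT
     | move=> _; rewrite [[set _; _]]setUC eqxx ?orbT].
Qed.

Lemma cycle3 E : E \in cycles_upto 3 ->
  exists a b c : T, [/\ uniq [:: a; b; c],
    forall x : T, (x \in [set a; b; c]) = (1 <= x <= 3)
    & E = [set [set a; b]; [set b; c]; [set c; a]]].
Proof.
case/cycles_uptoP=> s [+ U mE EE].
case: s U mE EE => [|a [|b [|c [|? ?]]]] // U mE EE _; exists a, b, c; split=> //.
  by move=> x; rewrite -mE !inE orbA.
rewrite EE cyclic_edges_cons//=; apply/setP=> e; rewrite !inE.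
by rewrite orbC.
Qed.

Lemma cycle3_eq P Q : P \in cycles_upto 3 -> Q \in cycles_upto 3 -> P = Q.
Proof.
move=> /cycle3[a [b [c [U mE ->]]]] /cycle3[a' [b' [c' [U' mE' ->]]]].
have eqV : [set a; b; c] = [set a'; b'; c'] by apply/setP=> x; rewrite mE mE'.
by apply/setP=> e; rewrite !triangle// eqV.
Qed.

End Cycles.

(** * Edge counts under insertion *)

Section Insertion.
Variable T : finType.
Implicit Types (v x : T) (a e f : {set T}) (A E : {set {set T}}).

Lemma mem_insert_old v e E f : v \notin f ->
  (f \in insert_node v e E) = (f != e) && (f \in E).
Proof.
move=> vf; rewrite !inE; case: imsetP => // -[y _ fE].
by rewrite fE set21 in vf.
Qed.

Lemma mem_insert_new v e E y : {in E, forall f, v \notin f} ->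
  ([set v; y] \in insert_node v e E) = (y \in e).
Proof.
move=> vE; rewrite !inE; have -> : [set v; y] \in E = false.
  by apply: contraTF (set21 v y) => /vE.
rewrite andbF orbF; apply/imsetP/idP => [[z ze /eqP]|]; last by exists y.
by rewrite set2_eq => /eqP->.
Qed.

Lemma sum_insert v e E (F : {set T} -> nat) : {in E, forall f, v \notin f} ->
  \sum_(f in insert_node v e E) F f =
    \sum_(y in e) F [set v; y] + \sum_(f in E :\ e) F f.
Proof.
move=> vE; rewrite (big_setID [set [set v; y] | y in e]) /=.
rewrite /insert_node setUK [in X in _ + X]setDUl setDv set0U.
have /setDidPl-> : [disjoint E :\ e & [set [set v; y] | y in e]].
  rewrite -setI_eq0; apply/eqP/setP=> f; rewrite !inE; apply/negbTE/negP.
  by case/andP=> /andP[_ /vE vf] /imsetP[y _ fE]; rewrite fE set21 in vf.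
congr addn; rewrite big_imset //= => x y _ _ /eqP.
by rewrite set2_eq => /eqP.
Qed.

Lemma card_insert v e E : {in E, forall f, v \notin f} -> e \in E ->
  #|insert_node v e E| + 1 = #|e| + #|E|.
Proof.
move=> vE eE; rewrite -sum1_card sum_insert// !sum1_card.
by rewrite (cardsD1 e E) eE -addnA [1 + _]addnC.
Qed.

Lemma degree_insert v x e E : {in E, forall f, v \notin f} -> e \in E -> x != v ->
  \sum_(f in insert_node v e E) (x \in f) = \sum_(f in E) (x \in f).
Proof.
move=> vE eE xv; rewrite sum_insert// [RHS](big_setD1 e)//=; congr addn.
under eq_bigr do rewrite !inE (negbTE xv) /=.
have [xe|xe] := boolP (x \in e).
  rewrite (big_setD1 x)//= eqxx big1 // => y; rewrite !inE eq_sym.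
  by case/andP=> /negbTE->.
by rewrite big1 // => y ye; case: eqP ye xe => // -> ->.
Qed.

Lemma degree_insert_new v e E : {in E, forall f, v \notin f} ->
  \sum_(f in insert_node v e E) (v \in f) = #|e|.
Proof.
move=> vE; rewrite sum_insert// -sum1_card.
under eq_bigr do rewrite set21.
by rewrite [X in _ + X]big1 ?addn0// => f; rewrite !inE => /andP[_ /vE/negbTE->].
Qed.

(** The common edges gained join [v] to the nodes of [a :&: e]. Those lost are [a] if it lies in [E]
    and [e] if it lies in [A], counted once when they coincide. *)
Lemma card_common_insert v a e A E :
    {in A, forall f, v \notin f} -> {in E, forall f, v \notin f} ->
    a \in A -> e \in E ->
  #|insert_node v a A :&: insert_node v e E| + (a \in E) +
    ((e \in A) && (e != a)) = #|A :&: E| + #|a :&: e|.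
Proof.
move=> vA vE aA eE.
have sumI (X Y : {set {set T}}) : #|X :&: Y| = \sum_(f in Y) (f \in X).
  by rewrite -sum1dep_card [LHS]big_mkcondl; apply: eq_bigr => f _; case: (f \in X).
have cardI : #|a :&: e| = \sum_(y in e) (y \in a).
  by rewrite -sum1dep_card [LHS]big_mkcondl; apply: eq_bigr => y _; case: (y \in a).
rewrite !sumI sum_insert// cardI (eq_bigr (fun y => nat_of_bool (y \in a))); last first.
  by move=> y _; rewrite mem_insert_new.
rewrite [\sum_(f in E) _](big_setD1 e)//=.
rewrite (eq_bigr (fun f => ((f != a) && (f \in A) : nat))); last first.
  by move=> f /setD1P[_ /vE vf]; rewrite mem_insert_old.
have -> : \sum_(f in E :\ e) (f \in A) =
    \sum_(f in E :\ e) ((f != a) && (f \in A)) + ((a != e) && (a \in E)).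
  rewrite -[RHS]addnC; have [aEe|aEe] := boolP (a \in E :\ e).
    rewrite [in LHS](big_setD1 a)// [in RHS](big_setD1 a)//= eqxx aA /=.
    move: aEe; rewrite !inE => ->; congr addn; apply: eq_bigr => f.
    by rewrite !inE => /andP[->].
  move: (aEe); rewrite !inE => /negbTE->; apply: eq_bigr => f fE.
  by case: eqP fE aEe => // -> ->.
have [ae|ae] := eqVneq a e; rewrite ?(eq_sym e) ?ae ?andbT /=.
  rewrite andbF !addn0 eE; set X := \sum_(i in E :\ e) _; set Y := \sum_(i in e) _.
  by move: aA; rewrite ae => ->; lia.
by set X := \sum_(i in E :\ e) _; set Y := \sum_(i in e) _; lia.
Qed.
End Insertion.

(** * Size and degrees of a cycle, by induction on insertions *)

Section CycleProperties.
Variable n : nat.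
Local Notation T := 'I_n.+1.
Local Notation node m := (inord m : T).
Implicit Types (m : nat) (E P Q : edges n) (e : {set T}).

Lemma cycle_ind (K : nat -> edges n -> Prop) :
    (forall E, E \in cycles_upto n 3 -> K 3 E) ->
    (forall m E e, 2 < m < n -> E \in cycles_upto n m -> e \in E -> K m E ->
       K m.+1 (insert_node (node m.+1) e E)) ->
  forall m E, 2 < m <= n -> E \in cycles_upto n m -> K m E.
Proof.
move=> K3 KS m E /andP[m2]; elim: m m2 E => // m IH; rewrite ltnS leq_eqVlt.
case/orP=> [/eqP <- E _|m2 E mn EC]; first exact: K3.
have mn' : 2 < m < n by rewrite m2.
have [DC nD <-] := delete_cycle mn' EC.
by apply: KS => //; apply: IH => //; exact: ltnW.
Qed.

Lemma cycle_edge m E e : 2 < m <= n -> E \in cycles_upto n m -> e \in E ->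
  #|e| = 2 /\ forall x, x \in e -> 1 <= x <= m.
Proof.
move=> mn EC; move: e; pattern m, E; apply: cycle_ind mn EC.
  move=> {m}E /cycle3[a [b [c [U mE ->]]]] e.
  rewrite triangle// => /andP[/eqP-> /subsetP sub]; split=> // x /sub.
  by rewrite mE.
move=> {}m {}E e /andP[m2 mn] EC eE IH f; rewrite !inE => /orP[|/andP[_ /IH[-> fm]]].
  case/imsetP=> y ye ->; have [_ /(_ _ ye) ym] := IH _ eE.
  rewrite cards2 -val_eqE /= val_node//; split.
    by case: eqP ym => // <-; rewrite ltnn andbF.
  move=> x; rewrite !inE => /orP[] /eqP->; first by rewrite val_node ?leqnn.
  by have /andP[-> /leqW] := ym.
by split=> // x /fm /andP[-> /leqW].
Qed.

Lemma new_node_notin m E f : 2 < m < n -> E \in cycles_upto n m -> f \in E ->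
  node m.+1 \notin f.
Proof.
case/andP=> m2 mn EC fE.
have [_ fm] := cycle_edge (introT andP (conj m2 (ltnW mn))) EC fE.
by apply/negP=> /fm; rewrite val_node// ltnn andbF.
Qed.

Lemma card_cycle m E : 2 < m <= n -> E \in cycles_upto n m -> #|E| = m.
Proof.
move=> mn EC; pattern m, E; apply: cycle_ind mn EC.
  move=> {m}E /cycle3[a [b [c [U mE ->]]]].
  rewrite (_ : [set _; _; _] = [set e : {set T} | e \subset [set a; b; c] & #|e| == 2]).
    by rewrite cards_draws -setUA cardsU1 cards2; case/and3P: U; rewrite !inE => -> ->.
  by apply/setP=> e; rewrite triangle// inE andbC.
move=> {}m {}E e mn EC eE IH.
have mn' : 2 < m <= n by case/andP: mn => -> /ltnW.
have [e2 _] := cycle_edge mn' EC eE.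
by have := card_insert (fun f => @new_node_notin m E f mn EC) eE;
  rewrite IH e2 addn1 add2n => -[].
Qed.

Lemma degree_cycle m E (x : T) : 2 < m <= n -> E \in cycles_upto n m ->
  1 <= x <= m -> \sum_(e in E) (x \in e) = 2.
Proof.
move=> mn EC; pattern m, E; apply: cycle_ind mn EC.
  move=> {m}E /cycle3[a [b [c [U mE ->]]]].
  rewrite -mE => xabc; have /and3P[] := U.
  rewrite !inE negb_or => /andP[ab ac] bc _.
  have abN : [set a; b] \notin [set [set b; c]; [set c; a]].
    by rewrite !inE [[set a; b]]setUC set2_eq [[set b; a]]setUC [[set c; a]]setUC
      set2_eq negb_or ac.
  have bcN : [set b; c] \notin [set [set c; a]].
    by rewrite !inE [[set b; c]]setUC set2_eq eq_sym.
  rewrite -setUA big_setU1 // big_setU1 // big_set1 !inE.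
  move: xabc; rewrite !inE => /orP[/orP[]|] /eqP->.
  - by rewrite eqxx (negbTE ab) (negbTE ac).
  - by rewrite eqxx eq_sym (negbTE ab) (negbTE bc).
  by rewrite eqxx ![c == _]eq_sym (negbTE ac) (negbTE bc).
move=> {}m {}E e mn EC eE IH xm.
have mn' : 2 < m <= n by case/andP: mn => -> /ltnW.
have vE := fun f => @new_node_notin m E f mn EC.
have [->|xv] := eqVneq x (node m.+1).
  by rewrite degree_insert_new//; have [] := cycle_edge mn' EC eE.
rewrite degree_insert// IH//.
move: xv xm; rewrite -val_eqE /= val_node; last by case/andP: mn.
by rewrite [x <= m.+1]leq_eqVlt; case: eqP.
Qed.
End CycleProperties.

(** * Counting components by dominating sets *)

Section Domination.
Variable T : finType.
Implicit Types (V S : {set T}) (e : rel T).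

Definition dominates V e S := [forall x in V, exists s in S, connect e x s].

Lemma dominatesP V e S :
  reflect (forall x, x \in V -> exists2 s, s \in S & connect e x s)
    (dominates V e S).
Proof.
apply: (iffP forall_inP) => dS x /dS; first by case/exists_inP=> s; exists s.
by case=> s sS xs; apply/exists_inP; exists s.
Qed.

(* Equals the number of components, without choosing representatives: adding a *)
(* vertex only transforms a minimal dominating set. *)
Definition domination_number V e := #|[arg min_(S < V | dominates V e S) #|S|]|.

Lemma dominates_self V e : dominates V e V.
Proof. by apply/dominatesP=> x xV; exists x. Qed.

Lemma domination_number_le V e S : dominates V e S -> domination_number V e <= #|S|.
Proof.
by rewrite /domination_number; case: arg_minnP => [|S0 _ minS /minS//]; exact: dominates_self.
Qed.

Lemma domination_numberP V e :
  exists2 S, dominates V e S & #|S| = domination_number V e.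
Proof.
rewrite /domination_number; case: arg_minnP => [|S0 dS0 _]; first exact: dominates_self.
by exists S0.
Qed.

Lemma domination_number_gt0 V e x : x \in V -> 0 < domination_number V e.
Proof.
move=> xV; have [S /dominatesP/(_ _ xV)[s sS _] <-] := domination_numberP V e.
by apply/card_gt0P; exists s.
Qed.

Lemma domination_number1 V e : connect_sym e -> domination_number V e <= 1 ->
  {in V &, forall x y, connect e x y}.
Proof.
move=> es + x y xV yV; have [S /dominatesP dS <-] := domination_numberP V e.
have [s sS xs] := dS _ xV; have [t tS yt] := dS _ yV.
move=> /card_le1_eqP/(_ _ _ sS tS) st; apply: connect_trans xs _.
by rewrite es -st.
Qed.

Section AddVertex.
Variables (V V' : {set T}) (e e' : rel T) (v : T).
Hypotheses (sV : V' \subset v |: V) (se : subrel e e').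

Let sce : subrel (connect e) (connect e').
Proof. by apply: connect_sub => x y /se; exact: connect1. Qed.

Lemma domination_number_add : domination_number V' e' <= (domination_number V e).+1.
Proof.
have [S /dominatesP dS <-] := domination_numberP V e.
apply: leq_trans (domination_number_le (S := v |: S) _) _; last first.
  by rewrite cardsU1 -add1n leq_add2r leq_b1.
apply/dominatesP=> x /(subsetP sV); rewrite !inE => /orP[/eqP->|/dS[s sS xs]].
  by exists v; rewrite ?setU11.
by exists s; rewrite ?inE ?sS ?orbT //; apply: sce.
Qed.

Lemma domination_number_join :
    (v \in V' -> exists2 k, k \in V & e' v k) ->
  domination_number V' e' <= domination_number V e.
Proof.
move=> vk; have [S /dominatesP dS <-] := domination_numberP V e.
apply: domination_number_le; apply/dominatesP=> x xV'.
have := subsetP sV _ xV'; rewrite !inE => /orP[/eqP xv|/dS[s sS xs]]; last first.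
  by exists s => //; apply: sce.
rewrite {x}xv in xV' *; have [k /dS[s sS ks] evk] := vk xV'; exists s => //.
by apply: connect_trans (connect1 evk) (sce ks).
Qed.

(** The dominator of [k] becomes redundant: whatever reached it now reaches the dominator of [l]
    through [v], and so does [v] itself. *)
Lemma domination_number_merge k l : connect_sym e -> connect_sym e' ->
    k \in V -> l \in V -> e' v k -> e' v l -> ~~ connect e k l ->
  domination_number V' e' < domination_number V e.
Proof.
move=> es es' kV lV vk vl kl; have [S /dominatesP dS <-] := domination_numberP V e.
have [s sS ks] := dS _ kV; have [t tS lt] := dS _ lV.
have st : s != t.
  by apply: contraNneq kl => st; apply: connect_trans ks _; rewrite es st.
have vt : connect e' v t by apply: connect_trans (connect1 vl) (sce lt).
rewrite (cardsD1 s S) sS ltnS; apply: domination_number_le.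
apply/dominatesP=> x /(subsetP sV); rewrite inE in_set1 => /orP[/eqP->|/dS[r rS xr]].
  by exists t => //; rewrite !inE eq_sym st.
have [rs|rs] := eqVneq r s; last by exists r; rewrite ?inE ?rs //; apply: sce.
exists t; first by rewrite !inE eq_sym st.
apply: connect_trans vt; apply: connect_trans (sce xr) _; rewrite rs es'.
by apply: connect_trans (connect1 vk) (sce ks).
Qed.

End AddVertex.
End Domination.

(** * Insertion edges recorded in a cycle *)

Section History.
Variable n : nat.
Local Notation T := 'I_n.+1.
Local Notation node m := (inord m : T).
Local Notation cyc := (cycles_upto n).
Implicit Types (m : nat) (E P Q : edges n) (e : {set T}) (k x y : T).

(* [subcycle] and [nu] restarted from level m: they cannot be applied to a cycle *)
(* on 1, ..., m, as [delete_node] adds the edge [set0] when the node is absent. *)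
Definition subcycle_of m E (k : nat) : edges n :=
  foldr (fun j E => delete_node (inord j) E) E (iota k.+1 (m - k)).

Definition history m E k : {set T} :=
  if 4 <= k then neighbours (subcycle_of m E k) k
  else [set u : T | 1 <= u < k].

Lemma subcycle_of_id m E : subcycle_of m E m = E.
Proof. by rewrite /subcycle_of subnn. Qed.

Lemma subcycle_of_trans l m (k : nat) E : k <= m <= l ->
  subcycle_of l E k = subcycle_of m (subcycle_of l E m) k.
Proof.
case/andP=> km ml; rewrite /subcycle_of -foldr_cat.
have -> : l - k = (m - k) + (l - m) by lia.
by rewrite iotaD; do 3!f_equal; lia.
Qed.

Lemma subcycle_of_pred m E : subcycle_of m.+1 E m = delete_node (node m.+1) E.
Proof. by rewrite /subcycle_of subSnn. Qed.

Lemma subcycle_ofP l m E : 2 < m <= l -> l <= n -> E \in cyc l ->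
  subcycle_of l E m \in cyc m.
Proof.
case/andP=> m2 /subnK <-; elim: (l - m) E => [|d IH] E ln EC.
  by rewrite subcycle_of_id.
rewrite (@subcycle_of_trans _ (d + m)) ?leq_addl ?leqnSn // subcycle_of_pred.
apply: IH; first exact: ltnW.
by have [] := delete_cycle _ EC; rewrite ?ln ?(leq_trans m2) ?leq_addl.
Qed.

Lemma history_sub l m k E : k <= m <= l ->
  history l E k = history m (subcycle_of l E m) k.
Proof. by move=> kml; rewrite /history (subcycle_of_trans _ kml). Qed.

Section Step.
Variables (m : nat) (E : edges n) (e : {set T}).
Hypotheses (mn : 2 < m < n) (EC : E \in cyc m) (eE : e \in E).

Lemma history_insert k : k <= m ->
  history m.+1 (insert_node (node m.+1) e E) k = history m E k.
Proof.
move=> km; have [_ _ dE] := insert_cycle mn EC eE.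
by rewrite (@history_sub _ m) ?km ?leqnSn // subcycle_of_pred dE.
Qed.

Lemma history_insert_new :
  history m.+1 (insert_node (node m.+1) e E) (node m.+1) = e.
Proof.
have [_ nE _] := insert_cycle mn EC eE; case/andP: mn => m2 mn'.
by rewrite /history val_node// ltnS m2 subcycle_of_id.
Qed.
End Step.

Lemma history_lt m E k x : 2 < m <= n -> E \in cyc m -> k <= m ->
  x \in history m E k -> x < k.
Proof.
move=> mn EC; move: k; pattern m, E; apply: cycle_ind mn EC.
  move=> {m}E EC k k3; rewrite /history leqNgt ltnS k3 /= inE.
  by case/andP.
move=> {}m {}E e mn EC eE IH k; rewrite leq_eqVlt ltnS => /orP[km|km]; last first.
  by rewrite history_insert//; exact: IH.
case/andP: (mn) => m2 mn'.
have -> : k = node m.+1 by apply/val_inj; rewrite /= val_node//; apply/eqP.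
rewrite history_insert_new// => xe; rewrite val_node// ltnS.
have mle : 2 < m <= n by rewrite m2 ltnW.
by have [_ /(_ _ xe)/andP[]] := cycle_edge mle EC eE.
Qed.

End History.

(** * Growth of the pedigree graph node by node *)

Section PedigreeGraph.
Variable n : nat.
Local Notation T := 'I_n.+1.
Local Notation node m := (inord m : T).
Local Notation cyc := (cycles_upto n).
Implicit Types (m : nat) (E P Q : edges n) (e p q : {set T}) (k l x y : T).

(* With f the history of Q and e the insertion edge of a new node in P, k is the *)
(* earlier vertex which this node is joined to by rules (i) and (iii). *)
Definition target (f : T -> {set T}) k e : bool :=
  (f k == e) || ((k == \max_(u in e) u :> nat) && (f k :&: e == set0)).

Definition vertices_upto m P Q : {set T} :=
  [set k : T | (4 <= k <= m) && (history m P k != history m Q k)].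

Definition adjacent_upto m P Q k l : bool :=
  target (history m Q) k (history m P l) || target (history m P) k (history m Q l).

Definition graph_upto m P Q : rel T :=
  [rel x y | [&& x \in vertices_upto m P Q, y \in vertices_upto m P Q
    & ((x < y) && adjacent_upto m P Q x y) || ((y < x) && adjacent_upto m P Q y x)]].

Lemma vertices_uptoC m P Q : vertices_upto m P Q = vertices_upto m Q P.
Proof. by apply/setP=> k; rewrite !inE eq_sym. Qed.

Lemma graph_upto_sym m P Q : symmetric (graph_upto m P Q).
Proof. by move=> x y; rewrite /graph_upto /= andbCA orbC. Qed.

Lemma cycle_ind2 (K : nat -> edges n -> edges n -> Prop) :
    (forall P, P \in cyc 3 -> K 3 P P) ->
    (forall m P p Q q, 2 < m < n -> P \in cyc m -> p \in P -> Q \in cyc m ->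
       q \in Q -> K m P Q ->
       K m.+1 (insert_node (node m.+1) p P) (insert_node (node m.+1) q Q)) ->
  forall m P Q, 2 < m <= n -> P \in cyc m -> Q \in cyc m -> K m P Q.
Proof.
move=> K3 KS m P Q /andP[m2]; elim: m m2 P Q => // m IH; rewrite ltnS leq_eqVlt.
case/orP=> [/eqP <- P Q _ PC QC|m2 P Q mn PC QC].
  by rewrite (cycle3_eq QC PC); exact: K3.
have mn' : 2 < m < n by rewrite m2.
have [PC' pP <-] := delete_cycle mn' PC; have [QC' qQ <-] := delete_cycle mn' QC.
by apply: KS => //; apply: IH => //; exact: ltnW.
Qed.

Section Step.
Variables (m : nat) (P Q : edges n) (p q : {set T}).
Hypotheses (mn : 2 < m < n) (PC : P \in cyc m) (QC : Q \in cyc m).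
Hypotheses (pP : p \in P) (qQ : q \in Q).
Local Notation v := (node m.+1).
Local Notation P1 := (insert_node v p P).
Local Notation Q1 := (insert_node v q Q).
Local Notation V := (vertices_upto m P Q).
Local Notation V1 := (vertices_upto m.+1 P1 Q1).

Let mle : 2 < m <= n. Proof. by case/andP: mn => -> /ltnW. Qed.
Let vm : v = m.+1 :> nat. Proof. by rewrite val_node//; case/andP: mn. Qed.

Lemma mem_vertices_insert k : (k \in V1) = ((k == v) && (p != q)) || (k \in V).
Proof.
rewrite !inE; have [->|kv] := eqVneq k v.
  rewrite !history_insert_new// vm leqnn ltnn !andbF orbF !andbT.
  by rewrite ltnS; case/andP: mn => ->.
have [km|km] := leqP k m; first by rewrite !history_insert// (leqW km).
have -> : (k <= m.+1) = false; last by rewrite !andbF.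
by move: kv; rewrite -val_eqE /= vm; lia.
Qed.

Lemma vertices_le k : k \in V -> k <= m.
Proof. by rewrite inE => /andP[/andP[]]. Qed.

Lemma max_new_edge e y : y \in e -> e \in P -> \max_(u in [set v; y]) u = v :> nat.
Proof.
move=> ye eP; have [_ /(_ _ ye)/andP[_ ym]] := cycle_edge mle PC eP.
rewrite big_setU1 /= ?big_set1; last first.
  by rewrite inE -val_eqE /= vm; case: eqP ym => // <-; rewrite ltnn.
by apply/maxn_idPl; rewrite vm leqW.
Qed.

Lemma max_old_edge e : e \in P -> \max_(u in e) u <= m.
Proof.
move=> eP; apply/bigmax_leqP => u ue.
by have [_ /(_ _ ue)/andP[]] := cycle_edge mle PC eP.
Qed.

Lemma target_old k e : k \in V ->
  target (history m.+1 P1) k e = target (history m P) k e.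
Proof. by move=> /vertices_le km; rewrite /target history_insert. Qed.

(** A later insertion never revises the history of an older node. *)
Lemma graph_insert_sub : subrel (graph_upto m P Q) (graph_upto m.+1 P1 Q1).
Proof.
move=> x y /and3P[xV yV xy]; apply/and3P; split; rewrite ?mem_vertices_insert ?xV ?yV ?orbT //.
by move: xy; rewrite /adjacent_upto /target !history_insert// vertices_le.
Qed.

Lemma graph_insert_new k : p != q -> k \in V ->
  graph_upto m.+1 P1 Q1 v k =
    target (history m Q) k p || target (history m P) k q.
Proof.
move=> pq kV; have km := vertices_le kV.
rewrite /graph_upto /= !mem_vertices_insert eqxx pq kV orbT /= vm.
rewrite ltnNge (leqW km) /= ltnS km /= /adjacent_upto /target.
by rewrite !history_insert_new// !history_insert.
Qed.
End Step.

(** There are two ways for [e] to be missing from [Q]. Either [Q] had it and subdivided it, and the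
    node inserted there is a target by equality; or it never appeared in [Q], because its larger
    node was inserted into an edge of [Q] disjoint from [e], and that larger node is a target. *)
Lemma exists_target m P Q e : 2 < m <= n -> P \in cyc m -> Q \in cyc m ->
    e \in P -> e \notin Q ->
  exists2 k, k \in vertices_upto m P Q & target (history m Q) k e.
Proof.
move=> mn PC QC; move: e; pattern m, P, Q; apply: cycle_ind2 mn PC QC.
  by move=> {m}P PC e ->.
move=> {}m {}P p {}Q q mn PC pP QC qQ IH e.
have vP f := @new_node_notin _ m P f mn PC; have vQ f := @new_node_notin _ m Q f mn QC.
have [_ nvq] : #|q| = 2 /\ forall x, x \in q -> 1 <= x <= m.
  by apply: cycle_edge QC qQ; case/andP: mn => -> /ltnW.
rewrite [e \in _]inE => /orP[/imsetP[y yp ->]|/setD1P[ep eP]].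
  rewrite mem_insert_new// => yq; exists (node m.+1).
    rewrite mem_vertices_insert// eqxx /=.
    by rewrite (contraNneq _ yq)// => <-.
  rewrite /target history_insert_new//.
  rewrite (max_new_edge mn PC yp pP) eqxx /=; apply/orP; right.
  apply/eqP/setP=> z; rewrite !inE; apply/negbTE/negP=> /andP[zq /orP[]/eqP zE].
    by move: (vQ _ qQ); rewrite -zE zq.
  by rewrite -zE zq in yq.
rewrite mem_insert_old ?vP// negb_and negbK; have [eQ|eQ _] := boolP (e \in Q).
  rewrite orbF => /eqP eq; exists (node m.+1).
    by rewrite mem_vertices_insert// eqxx -eq eq_sym ep.
  by rewrite /target history_insert_new// eq eqxx.
have [k kV tk] := IH _ eP eQ; exists k; first by rewrite mem_vertices_insert// kV orbT.
by rewrite (@target_old _ Q P) // vertices_uptoC.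
Qed.

(* An edge of Q that is not in P stays out of P, so the component keeps it until *)
(* a node is inserted into it in Q; that node joins the component and brings a *)
(* new such edge. *)
Lemma component_edge m P Q x : 2 < m <= n -> P \in cyc m -> Q \in cyc m ->
    x \in vertices_upto m P Q ->
  exists e, [/\ e \in Q, e \notin P & forall k, k \in vertices_upto m P Q ->
    target (history m P) k e -> connect (graph_upto m P Q) x k].
Proof.
move=> mn PC QC; move: x; pattern m, P, Q; apply: cycle_ind2 mn PC QC.
  by move=> {m}P PC x; rewrite inE eqxx andbF.
move=> {}m {}P p {}Q q mn PC pP QC qQ IH x.
have vP f := @new_node_notin _ m P f mn PC; have vQ f := @new_node_notin _ m Q f mn QC.
have mle : 2 < m <= n by case/andP: mn => -> /ltnW.
have [p2 _] := cycle_edge mle PC pP; have [q2 _] := cycle_edge mle QC qQ.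
have vm : node m.+1 = m.+1 :> nat by rewrite val_node//; case/andP: mn.
set P1 := insert_node _ p P; set Q1 := insert_node _ q Q.
set V1 := vertices_upto _ _ _; set V := vertices_upto m P Q in IH.
(* The edge joins the new node to a [y] in [q] but not in [p]. No older node is a target, since
   histories of older nodes avoid the new node and the maximum of the edge is the new node. *)
have new : p != q -> exists e, [/\ e \in Q1, e \notin P1
    & forall k, k \in V1 -> target (history m.+1 P1) k e -> k = node m.+1].
  move=> pq; have /subsetPn[y yq yp] : ~~ (q \subset p).
    by apply: contraNN pq => qp; rewrite eq_sym eqEcard qp p2 q2.
  exists [set node m.+1; y]; split; rewrite ?mem_insert_new //.
  move=> k; rewrite /V1 mem_vertices_insert// => /orP[/andP[/eqP//]|kV].
  have km := vertices_le kV; rewrite (target_old mn PC pP _ kV) => /orP[/eqP hk|/andP[/eqP km1 _]].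
    have := @history_lt _ m P k (node m.+1) mle PC km.
    by rewrite hk set21 vm => /(_ isT) /ltnW; rewrite ltnNge km.
  apply: val_inj => /=; rewrite km1 (max_new_edge mn QC yq qQ).
  by [].
have nodeV1 : p != q -> node m.+1 \in V1.
  by move=> pq; rewrite mem_vertices_insert// eqxx pq.
have sub : subrel (connect (graph_upto m P Q)) (connect (graph_upto m.+1 P1 Q1)).
  by apply: connect_sub => a b /(graph_insert_sub mn PC QC pP qQ); exact: connect1.
rewrite {1}/V1 mem_vertices_insert// => /orP[/andP[/eqP-> pq]|xV].
  have [e [eQ eP tk]] := new pq; exists e; split=> // k kV1 /(tk _ kV1)->.
  exact: connect0.
have [e [eQ eP tk]] := IH _ xV.
have [eq|eq] := eqVneq e q; last first.
  exists e; split.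
  - by rewrite mem_insert_old ?eq ?vQ.
  - by rewrite mem_insert_old ?vQ// negb_and eP orbT.
  move=> k; rewrite /V1 mem_vertices_insert// => /orP[/andP[/eqP-> pq]|kV]; last first.
    by rewrite (target_old mn PC pP _ kV) => /(tk _ kV); exact: sub.
  (* The new node is not a target of [e]: [p] differs from [e], as [e] is not in [P], and the
     largest node of [e] is at most m. *)
  rewrite /target history_insert_new// => /orP[/eqP pe|/andP[/eqP]].
    by rewrite -pe pP in eP.
  by have := max_old_edge mn QC eQ; rewrite vm => + /esym emax; rewrite emax ltnn.
(* Here the edge owned by the component is subdivided in [Q]: the new node joins the component
   through a target of [e], and the edge given by [new] replaces [e]. *)
have pq : p != q by rewrite eq in eP; apply: contraNneq eP => <-.
have [k] := exists_target mle QC PC eQ eP; rewrite vertices_uptoC => kV ke.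
have xv : connect (graph_upto m.+1 P1 Q1) x (node m.+1).
  apply: connect_trans (sub _ _ (tk k kV ke)) _; apply: connect1.
  by rewrite graph_upto_sym graph_insert_new// -eq ke orbT.
have [f [fQ fP fk]] := new pq; exists f; split=> // l lV1 /(fk _ lV1)->.
exact: xv.
Qed.
End PedigreeGraph.

(** * One-step drift of the excess, the weight and the potential *)

Section Potential.
Variable n : nat.
Local Notation T := 'I_n.+1.
Local Notation node m := (inord m : T).
Local Notation cyc := (cycles_upto n).
Implicit Types (m : nat) (E P Q : edges n) (e p q : {set T}) (k l x y : T).

(* 0 for the graph with no vertices, which is counted separately. *)
Definition excess m P Q : nat :=
  (domination_number (vertices_upto m P Q) (graph_upto m P Q)).-1.

(** A component can be created only by subdividing two distinct common edges, one in each cycle; the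
    loss of the second one pays for the new component, so the sum is insensitive to this event. *)
Definition weight m P Q : nat := #|P :&: Q| + excess m P Q.

(** The factor m - 1 offsets the decrease of the mean excess by a fraction 1 / m. The term W^2 + W
    falls by exactly 2 W when W falls by 1, which matches the factor 2. *)
Definition potential m P Q : nat :=
  2 * m.-1 * excess m P Q + weight m P Q ^ 2 + weight m P Q.

Lemma graph_upto_connect_sym m P Q : connect_sym (graph_upto m P Q).
Proof. exact/sym_connect_sym/graph_upto_sym. Qed.

Section Step.
Variables (m : nat) (P Q : edges n) (p : {set T}).
Hypotheses (mn : 2 < m < n) (PC : P \in cyc m) (QC : Q \in cyc m) (pP : p \in P).
Local Notation v := (node m.+1).
Local Notation P1 := (insert_node v p P).
Local Notation Q1 q := (insert_node v q Q).

Let mle : 2 < m <= n. Proof. by case/andP: mn => -> /ltnW. Qed.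
Let vP f (fP : f \in P) : v \notin f. Proof. exact: new_node_notin mn PC fP. Qed.
Let vQ f (fQ : f \in Q) : v \notin f. Proof. exact: new_node_notin mn QC fQ. Qed.

Lemma vertices_insert_sub q : q \in Q ->
  vertices_upto m.+1 P1 (Q1 q) \subset v |: vertices_upto m P Q.
Proof.
move=> qQ; apply/subsetP=> k; rewrite mem_vertices_insert// in_setU1.
by case/orP=> [/andP[->]|->]; rewrite ?orbT.
Qed.

(** If [p] is not in [Q] or [q] not in [P], then [exists_target] gives the new node an older
    neighbour; if [p = q], it is not a vertex at all. *)
Lemma excess_insert q : q \in Q ->
  excess m.+1 P1 (Q1 q) <= excess m P Q + [&& p \in Q, q \in P & q != p].
Proof.
move=> qQ; have sub := graph_insert_sub mn PC QC pP qQ.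
have sV := vertices_insert_sub qQ; rewrite /excess.
set d1 := domination_number _ (graph_upto m.+1 _ _).
set d := domination_number _ (graph_upto m _ _).
have [/and3P[pQ qP qp]|] := boolP [&& _, _ & _].
  have := domination_number_add sV sub; rewrite -/d -/d1 /= => le_d1.
  by clearbody d d1; rewrite addn1; lia.
rewrite !negb_and negbK => back; suff: d1 <= d by clearbody d d1; rewrite addn0; lia.
apply: (domination_number_join sV sub).
rewrite mem_vertices_insert// eqxx /=.
have vN : v \in vertices_upto m P Q = false.
  by apply/negP=> /vertices_le; rewrite val_node ?ltnn//; case/andP: mn.
rewrite vN orbF => pq; move: back; rewrite eq_sym (negbTE pq) orbF.
case/orP=> [pQ|qP].
  have [k kV tk] := exists_target mle PC QC pP pQ.
  by exists k => //; rewrite graph_insert_new// tk.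
have [k] := exists_target mle QC PC qQ qP; rewrite vertices_uptoC => kV tk.
by exists k => //; rewrite graph_insert_new// tk orbT.
Qed.

Lemma weight_insert q : q \in Q ->
  weight m.+1 P1 (Q1 q) + (p \in Q) <= weight m P Q + #|p :&: q|.
Proof.
move=> qQ; have := card_common_insert vP vQ pP qQ.
have := excess_insert qQ; rewrite /weight.
move: #|P1 :&: Q1 q| #|P :&: Q| #|p :&: q| (excess _ _ _) (excess _ _ _) => a b c d f.
by case: (p \in Q) => /=; case: (_ && _) => /=; lia.
Qed.

(** If [p] is in [Q], only common edges [q] can raise the excess, and the excess contained in the
    weight pays for the extra term on the left. Otherwise no [q] raises it, and at least
    [excess m P Q] choices of [q] lower it. *)
Lemma sum_excess_insert :
  \sum_(q in Q) excess m.+1 P1 (Q1 q) + excess m P Q <=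
    m * excess m P Q + (p \in Q) * weight m P Q.
Proof.
have sumc c : \sum_(q in Q) c = m * c by rewrite sum_nat_const (card_cycle mle QC).
have [pQ|pQ] := boolP (p \in Q); rewrite ?mul1n ?mul0n ?addn0.
  rewrite /weight addnA leq_add2r -[X in _ <= X + _]sumc.
  have -> : #|P :&: Q| = \sum_(q in Q) (q \in P).
    by rewrite -sum1dep_card [LHS]big_mkcondl; apply: eq_bigr => f _; case: (f \in P).
  rewrite -big_split; apply: leq_sum => q qQ /=.
  apply: leq_trans (excess_insert qQ) _; rewrite leq_add2l pQ /=.
  by case: (q \in P) => //=; exact: leq_b1.
have [k kV tk] := exists_target mle PC QC pP pQ.
(* The new node is always joined to [k]; a [q] with a target [l] outside the component of [k] joins
   it to a second component. *)
pose far q l := [&& l \in vertices_upto m P Q, target (history m P) l q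
  & ~~ connect (graph_upto m P Q) k l].
pose D := [set q in Q | (q \notin P) && [exists l, far q l]].
have leD : excess m P Q <= #|D|.
  rewrite /excess -subn1 leq_subLR.
  (* Together with [k], the targets chosen for [D] meet every component, so the number of components
     is at most 1 + [#|D|]. The default [k] is never taken on [D]. *)
  pose tau q := odflt k [pick l | far q l].
  apply: leq_trans (domination_number_le (S := k |: tau @: D) _) _; last first.
    by rewrite cardsU1 leq_add ?leq_b1 ?leq_imset_card.
  apply/dominatesP=> x xV; have [e [eQ eP ek]] := component_edge mle PC QC xV.
  have [l] := exists_target mle QC PC eQ eP; rewrite vertices_uptoC => lV tl.
  have [kl|kl] := boolP (connect (graph_upto m P Q) k l).
    exists k; first exact: setU11.
    by apply: connect_trans (ek _ lV tl) _; rewrite graph_upto_connect_sym.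
  have fl : far e l by rewrite /far lV tl kl.
  have eD : e \in D by rewrite inE eQ eP; apply/existsP; exists l.
  exists (tau e); first by rewrite inE imset_f ?orbT.
  by rewrite /tau; case: pickP => [l' /and3P[l'V tl' _]|/(_ l)]; [exact: ek|rewrite fl].
have cardD : #|D| = \sum_(q in Q) (q \in D).
  rewrite -sum1_card [LHS]big_mkcond [RHS]big_mkcond; apply: eq_bigr => q _.
  by rewrite inE; case: (q \in Q) => //=; case: (_ && _).
apply: leq_trans (leq_add (leqnn _) leD) _.
rewrite cardD -big_split -sumc; apply: leq_sum => q qQ /=.
have exq : excess m.+1 P1 (Q1 q) <= excess m P Q.
  by apply: leq_trans (excess_insert qQ) _; rewrite (negbTE pQ) /= addn0.
have [qD|_] := boolP (q \in D); last by rewrite addn0.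
move: qD; rewrite inE qQ /= => /andP[_ /existsP[l /and3P[lV tl kl]]].
have pq : p != q by apply: contraNneq pQ => ->.
have v1 : v \in vertices_upto m.+1 P1 (Q1 q) by rewrite mem_vertices_insert// eqxx pq.
have sub := graph_insert_sub mn PC QC pP qQ.
have gt0 := domination_number_gt0 (graph_upto m.+1 P1 (Q1 q)) v1.
suff lt : domination_number (vertices_upto m.+1 P1 (Q1 q)) (graph_upto m.+1 P1 (Q1 q)) <
    domination_number (vertices_upto m P Q) (graph_upto m P Q).
  by rewrite /excess addn1 (prednK gt0) -ltnS (ltn_predK lt).
apply: (domination_number_merge (vertices_insert_sub qQ) sub _ _ kV lV _ _ kl).
- exact: graph_upto_connect_sym.
- exact: graph_upto_connect_sym.
- by rewrite graph_insert_new// tk.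
by rewrite graph_insert_new// tl orbT.
Qed.

(** Double counting: each of the two ends of [p] has degree 2 in [Q]. *)
Lemma sum_meet : \sum_(q in Q) #|p :&: q| = 4.
Proof.
have [p2 pm] := cycle_edge mle PC pP.
transitivity (\sum_(q in Q) \sum_(y in p) (y \in q)).
  apply: eq_bigr => q _.
  by rewrite setIC -sum1dep_card [LHS]big_mkcondl; apply: eq_bigr => f _; case: (f \in q).
rewrite exchange_big (eq_bigr (fun=> 2)) => [|y /pm ym]; last exact: degree_cycle mle QC ym.
by rewrite sum_nat_const p2.
Qed.

Lemma sum_weight_insert :
  \sum_(q in Q) weight m.+1 P1 (Q1 q) <= m * weight m P Q + 4.
Proof.
have -> : m * weight m P Q = \sum_(q in Q) weight m P Q.
  by rewrite sum_nat_const (card_cycle mle QC).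
rewrite -sum_meet -big_split; apply: leq_sum => q qQ /=.
by apply: leq_trans (weight_insert qQ); exact: leq_addr.
Qed.

Lemma sum_potential_insert :
  \sum_(q in Q) potential m.+1 P1 (Q1 q) <=
    m * potential m P Q + 8 * weight m P Q + 12.
Proof.
set W := weight m P Q; set i := nat_of_bool (p \in Q).
have sumc c : \sum_(q in Q) c = m * c by rewrite sum_nat_const (card_cycle mle QC).
pose w1 q := weight m.+1 P1 (Q1 q); pose e1 q := excess m.+1 P1 (Q1 q).
(* Termwise, with g = [#|p :&: q|] and W' <= W + g - i, the increase is at most 2 W g + g^2 + g - 2
   i W, and g^2 <= 2 g since g <= 2. *)
have wq : \sum_(q in Q) (w1 q ^ 2 + w1 q) + m * (2 * i * W) <=
    m * (W ^ 2 + W) + (2 * W + 3) * 4.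
  have -> : m * (W ^ 2 + W) + (2 * W + 3) * 4 =
      \sum_(q in Q) (W ^ 2 + W + (2 * W + 3) * #|p :&: q|).
    by rewrite big_split -big_distrr /= sumc sum_meet.
  rewrite -(sumc (2 * i * W)) -big_split; apply: leq_sum => q qQ /=.
  have := weight_insert qQ; rewrite -/W -/(w1 q).
  have : #|p :&: q| <= 2.
    have [<- _] := cycle_edge mle PC pP; exact/subset_leq_card/subsetIl.
  rewrite /i; move: (w1 q) (W) #|p :&: q|.
  case: (p \in Q) => a b g /=; nia.
have exs : \sum_(q in Q) e1 q + excess m P Q <= m * excess m P Q + i * W.
  exact: sum_excess_insert.
have -> : \sum_(q in Q) potential m.+1 P1 (Q1 q) =
    2 * m * (\sum_(q in Q) e1 q) + \sum_(q in Q) (w1 q ^ 2 + w1 q).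
  by rewrite big_distrr -big_split; apply: eq_bigr => q _ /=; rewrite addnA.
rewrite /potential -/W.
have m0 : 0 < m by case/andP: mn => /ltnW/ltnW.
clearbody W i; move: wq exs; move: (excess m P Q) (\sum_(q in Q) e1 q)
  (\sum_(q in Q) (w1 q ^ 2 + w1 q)) => e s1 s2.
(* Multiplied by 2 m, the error [i * W] becomes the term on the left of [wq] and cancels. *)
case: (m) m0 => // m' _ wq exs; have s1le : s1 <= m' * e + i * W by lia.
by have := leq_mul (leqnn (2 * m'.+1)) s1le; nia.
Qed.
End Step.
End Potential.

(** * Summation over all cycles against a fixed cycle *)

Section Counting.
Variable n : nat.
Local Notation T := 'I_n.+1.
Local Notation node m := (inord m : T).
Local Notation cyc := (cycles_upto n).
Implicit Types (m : nat) (E P Q : edges n) (e p q : {set T}) (k l x y : T).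

(** Insertion is a bijection from pairs of a cycle and one of its edges to cycles with one more
    node; its inverse deletes the last node and records its neighbours. This replaces conditional
    expectation. *)
Lemma sum_cycles m (F : edges n -> nat) : 2 < m < n ->
  \sum_(E in cyc m.+1) F E =
    \sum_(E in cyc m) \sum_(e in E) F (insert_node (node m.+1) e E).
Proof.
move=> mn; set v := node m.+1; rewrite pair_big_dep /=.
pose h (j : edges n * {set T}) := insert_node v j.2 j.1.
pose h' E := (delete_node v E, neighbours E v).
rewrite (reindex_onto h h') => [|E EC]; last by have [] := delete_cycle mn EC.
apply: eq_bigl => -[E e]; rewrite /h /h' /=; apply/andP/andP => [[EC /eqP[dE nE]]|[EC eE]].
  by have := delete_cycle mn EC; rewrite /= -/v dE nE => -[].
by have [E1C nE dE] := insert_cycle mn EC eE; rewrite -/v in nE dE; rewrite nE dE eqxx.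
Qed.

Lemma card_cycles m : 2 < m < n -> #|cyc m.+1| = m * #|cyc m|.
Proof.
move=> mn; rewrite -sum1_card sum_cycles// mulnC -sum_nat_const.
apply: eq_bigr => E EC; rewrite sum1_card (card_cycle _ EC)//.
by case/andP: mn => -> /ltnW.
Qed.

Lemma excess3 P Q : excess 3 P Q = 0.
Proof.
apply/eqP; rewrite -leqn0 /excess -subn1 leq_subLR.
apply: leq_trans (domination_number_le (dominates_self _ _)) _.
suff -> : vertices_upto 3 P Q = set0 by rewrite cards0.
by apply/setP=> k; rewrite !inE leqNgt ltnS; case: (k <= 3).
Qed.

Lemma weight3 P Q : 3 <= n -> P \in cyc 3 -> weight 3 P Q <= 3.
Proof.
move=> n3 PC; rewrite /weight excess3 addn0 -[X in _ <= X](card_cycle _ PC) //.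
exact/subset_leq_card/subsetIl.
Qed.

Lemma potential3 P Q : 3 <= n -> P \in cyc 3 -> potential 3 P Q <= 12.
Proof.
by move=> n3 PC; have := weight3 Q n3 PC; rewrite /potential excess3; nia.
Qed.

Section Adversary.
Variable A : edges n.
Hypothesis AC : A \in cyc n.
Local Notation A_ m := (subcycle_of n A m).

Lemma subcycle_step m : 2 < m < n ->
  A_ m \in cyc m /\ exists2 a, a \in A_ m & A_ m.+1 = insert_node (node m.+1) a (A_ m).
Proof.
case/andP=> m2 mn; have AmC : A_ m \in cyc m.
  by apply: subcycle_ofP => //; rewrite m2 ltnW.
have Am1C : A_ m.+1 \in cyc m.+1 by apply: subcycle_ofP => //; rewrite ltnS (ltnW m2).
have mn' : 2 < m < n by rewrite m2.
have [_ nA iA] := delete_cycle mn' Am1C.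
have dA : delete_node (node m.+1) (A_ m.+1) = A_ m.
  by rewrite -subcycle_of_pred -subcycle_of_trans ?leqnSn.
by split=> //; rewrite dA in nA iA; exists (neighbours (A_ m.+1) (node m.+1)).
Qed.

Lemma sum_weight_step m : 2 < m < n ->
  \sum_(E in cyc m.+1) weight m.+1 (A_ m.+1) E <=
    m * (\sum_(E in cyc m) weight m (A_ m) E) + 4 * #|cyc m|.
Proof.
move=> mn; have [AmC [a aA ->]] := subcycle_step mn.
apply: leq_trans (eq_leq (sum_cycles _ mn)) _.
apply: (@leq_trans (\sum_(E in cyc m) (m * weight m (A_ m) E + 4))).
  by apply: leq_sum => E EC; exact: sum_weight_insert.
by rewrite big_split /= -big_distrr /= sum_nat_const [#|_| * _]mulnC.
Qed.

Lemma sum_potential_step m : 2 < m < n ->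
  \sum_(E in cyc m.+1) potential m.+1 (A_ m.+1) E <=
    m * (\sum_(E in cyc m) potential m (A_ m) E)
    + 8 * (\sum_(E in cyc m) weight m (A_ m) E) + 12 * #|cyc m|.
Proof.
move=> mn; have [AmC [a aA ->]] := subcycle_step mn.
apply: leq_trans (eq_leq (sum_cycles _ mn)) _.
apply: (@leq_trans (\sum_(E in cyc m)
    (m * potential m (A_ m) E + 8 * weight m (A_ m) E + 12))).
  by apply: leq_sum => E EC; exact: sum_potential_insert.
by rewrite 2!big_split /= -2!big_distrr /= sum_nat_const [#|_| * _]mulnC.
Qed.

Lemma pedigree_vertices_upto B : pedigree_vertices A B = vertices_upto n A B.
Proof. by apply/setP=> k; rewrite !inE leq_ord andbT. Qed.

Lemma pedigree_edge_upto B : pedigree_edge A B =2 graph_upto n A B.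
Proof.
have adjE x y : pedigree_adj A B x y = adjacent_upto n A B x y.
  by rewrite /pedigree_adj [nu A y == _]eq_sym [nu B y == _]eq_sym orbA orbACA.
by move=> x y; rewrite /pedigree_edge /graph_upto /= pedigree_vertices_upto !adjE.
Qed.

Lemma not_connected B : ~~ pedigree_connected A B ->
  1 <= excess n A B + (vertices_upto n A B == set0).
Proof.
rewrite /pedigree_connected /connected_graph pedigree_vertices_upto negb_and negbK.
case/orP=> [->|]; first by rewrite addn1.
apply: contraR; rewrite -leqNgt leqn0 addn_eq0 => /andP[/eqP ex0 _].
apply/forall_inP=> x xV; apply/forall_inP=> y yV.
rewrite (eq_connect (pedigree_edge_upto B)).
apply: (domination_number1 (graph_upto_connect_sym n A B)) xV yV.
by move: ex0; rewrite /excess; case: domination_number => [|[]].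
Qed.

(** The last node is not a vertex only if its insertion edges agree, so at most one extension of
    each smaller cycle counts. *)
Lemma sum_no_vertices m : 2 < m -> m.+1 = n ->
  \sum_(E in cyc m.+1) (vertices_upto m.+1 (A_ m.+1) E == set0) <= #|cyc m|.
Proof.
move=> m2 mn; have mn' : 2 < m < n by rewrite m2 -mn ltnS leqnn.
have [AmC [a aA ->]] := subcycle_step mn'.
rewrite sum_cycles// -sum1_card; apply: leq_sum => E EC.
apply: (@leq_trans (\sum_(e in E) (e == a))).
  apply: leq_sum => e eE; case: eqVneq => // V0; rewrite lt0b.
  have := mem_vertices_insert mn' AmC EC aA eE (node m.+1).
  by rewrite V0 inE eqxx eq_sym /= => /esym; case: eqP.
have [aE|aE] := boolP (a \in E); last first.
  by rewrite big1 // => e eE; case: eqP eE aE => // -> ->.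
rewrite (big_setD1 a)//= eqxx big1 // => e; rewrite !inE.
by case/andP=> /negbTE->.
Qed.
End Adversary.
End Counting.

(** * Harmonic sums and the resulting bounds on the means *)

Section Asymptotics.
Variable R : realType.
Local Open Scope ring_scope.

(** This sum solves the recurrence for the mean weight. The leading 1 covers the base case and lets
    constants be absorbed into multiples of the sum. *)
Definition harmonic3 (m : nat) : R := 1 + \sum_(3 <= k < m) k%:R^-1.

Lemma harmonic3S m : (3 <= m)%N -> harmonic3 m.+1 = harmonic3 m + m%:R^-1.
Proof. by move=> m3; rewrite /harmonic3 big_nat_recr //= addrA. Qed.

Lemma harmonic3_ge1 m : 1 <= harmonic3 m.
Proof. by rewrite lerDl sumr_ge0 // => k _; rewrite invr_ge0. Qed.

(** A linear bound on the cube makes the square o(m) without logarithms. With s the sum and t = 1 /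
    m, the three bounds at m give t s <= 1 and t s^2 <= 3, so the increments of the square and the
    cube are at most 2 + 1 = 3 and 9 + 3 + 1 = 13. *)
Lemma harmonic3_cube m : (3 <= m)%N -> harmonic3 m ^+ 3 <= 13 * m%:R.
Proof.
move=> m3; suff [] : [/\ harmonic3 m <= m%:R, harmonic3 m ^+ 2 <= 3 * m%:R
  & harmonic3 m ^+ 3 <= 13 * m%:R] by [].
elim: m m3 => // m IH; rewrite leq_eqVlt => /orP[/eqP<-|m3].
  by rewrite /harmonic3 big_geq // addr0 !expr1n; split; lra.
have [h1 h2 h3] := IH m3; have hS := harmonic3S m3.
have mS : m.+1%:R = m%:R + 1 :> R by rewrite -natr1.
have := harmonic3_ge1 m; move: h1 h2 h3; rewrite hS mS.
have m0 : 0 < m%:R :> R by rewrite ltr0n ltnW // ltnW.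
have m1 : 1 <= m%:R :> R by rewrite ler1n ltnW // ltnW.
set s := harmonic3 m; set t := m%:R^-1; set M := m%:R => h1 h2 h3 s1.
have t0 : 0 < t by rewrite invr_gt0.
have t1 : t <= 1 by rewrite invf_le1.
have tM : t * M = 1 by rewrite mulVf // gt_eqF.
have st : t * s <= 1 by rewrite -tM ler_pM2l.
have st2 : t * s ^+ 2 <= 3.
  have -> : 3 = t * (3 * M) by rewrite mulrCA tM mulr1.
  by rewrite ler_pM2l.
have t0' := ltW t0; have s0 : 0 <= s by apply: le_trans s1.
have tt : t * t <= 1 by rewrite mulr_ile1.
have ttt : t * t * t <= 1 by rewrite mulr_ile1 // mulr_ge0.
have tts : t * (t * s) <= 1 by rewrite mulr_ile1 // mulr_ge0.
by split; nra.
Qed.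

Lemma harmonic3_sqr_small (eps : R) : 0 < eps ->
  exists N : nat, forall m, (N <= m)%N -> 11 * harmonic3 m.+1 ^+ 2 + 1 <= eps * m%:R.
Proof.
(* By [harmonic3_cube], 12 s^3 <= 156 (m + 1) <= 312 m. So if s > K, then 12 s^2 <= 312 m / K = eps
   m; if s <= K, then m >= x suffices. *)
move=> eps0; pose K := 312 / eps; pose x := 12 * K ^+ 2 / eps.
have K0 : 0 < K by rewrite divr_gt0.
have x0 : 0 <= x by rewrite divr_ge0 ?ltW // mulr_gt0 ?exprn_gt0.
exists (maxn 3 (Num.bound x)) => m; rewrite geq_max => /andP[m3 xm].
have {}xm : x <= m%:R.
  by apply: ltW; apply: lt_le_trans (archi_boundP x0) _; rewrite ler_nat.
have := harmonic3_ge1 m.+1; have := @harmonic3_cube m.+1 (ltnW m3).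
have m1 : 1 <= m%:R :> R by rewrite ler1n ltnW // ltnW.
have mS : m.+1%:R = m%:R + 1 :> R by rewrite -natr1.
rewrite mS; set s := harmonic3 _; set M := m%:R in xm m1 *.
move=> s3 s1; have -> : eps * M = 312 * M / K by rewrite /K; field; rewrite gt_eqF.
apply: (@le_trans _ _ (12 * s ^+ 2)); first by nra.
have s0 : 0 < s by apply: lt_le_trans s1.
have [sK|Ks] := lerP s K.
  rewrite ler_pdivlMr //.
  have : x * eps <= M * eps by rewrite ler_pM2r.
  rewrite /x divfK ?gt_eqF // => xe.
  have -> : 312 * M = M * eps * K by rewrite /K; field; rewrite gt_eqF.
  by rewrite ler_pM2r //; apply: le_trans xe; rewrite ler_pM2l // ler_sqr // nnegrE ltW.
rewrite ler_pdivlMr //.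
apply: (@le_trans _ _ (12 * s ^+ 3)); last by nra.
by rewrite [s ^+ 3]exprSr mulrA ler_pM2l ?mulr_gt0 ?exprn_gt0 // ltW.
Qed.

Variables (n : nat) (A : edges n).
Hypothesis AC : A \in cycles_upto n n.
Local Notation A_ m := (subcycle_of n A m).
Local Notation cyc := (cycles_upto n).

Lemma sum_weight_le m : (2 < m <= n)%N ->
  (\sum_(E in cyc m) weight m (A_ m) E)%:R <= 4 * harmonic3 m * #|cyc m|%:R.
Proof.
case/andP; elim: m => // m IH; rewrite leq_eqVlt => /orP[/eqP<- n3|m2 mn].
  rewrite /harmonic3 big_geq // addr0 mulr1 -natrM ler_nat.
  rewrite mulnC -sum_nat_const; apply: leq_sum => E EC.
  by apply: leqW; apply: weight3 => //; apply: subcycle_ofP.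
have mn' : (2 < m < n)%N by exact/andP.
have := sum_weight_step AC mn'; rewrite -(ler_nat R) => /le_trans; apply.
rewrite card_cycles // harmonic3S // natrD !natrM.
have := IH m2 (ltnW mn).
have m0 : 0 < m%:R :> R by rewrite ltr0n ltnW // ltnW.
set w := (\sum_(_ in _) _)%:R; set N := #|_|%:R; set s := harmonic3 m => le_w.
have -> : 4 * (s + m%:R^-1) * (m%:R * N) = m%:R * (4 * s * N) + 4 * N.
  by field; rewrite gt_eqF.
by rewrite lerD2r ler_pM2l.
Qed.

Lemma sum_potential_le m : (2 < m <= n)%N ->
  (\sum_(E in cyc m) potential m (A_ m) E)%:R <=
    22 * harmonic3 m ^+ 2 * #|cyc m|%:R.
Proof.
case/andP; elim: m => // m IH; rewrite leq_eqVlt => /orP[/eqP<- n3|m2 mn].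
  rewrite /harmonic3 big_geq // addr0 expr1n mulr1 -natrM ler_nat.
  rewrite mulnC -sum_nat_const; apply: leq_sum => E EC.
  by apply: (@leq_trans 12) => //; apply: potential3 => //; apply: subcycle_ofP.
have mn' : (2 < m < n)%N by exact/andP.
have := sum_potential_step AC mn'; rewrite -(ler_nat R) => /le_trans; apply.
have := sum_weight_le (introT andP (conj m2 (ltnW mn))).
rewrite card_cycles // harmonic3S // 2!natrD !natrM.
have := IH m2 (ltnW mn).
have m0 : 0 < m%:R :> R by rewrite ltr0n ltnW // ltnW.
have := harmonic3_ge1 m.
have : 0 <= #|cyc m|%:R :> R by [].
set phi := (\sum_(_ in _) potential _ _ _)%:R; set w := (\sum_(_ in _) weight _ _ _)%:R.
set N := #|_|%:R; set s := harmonic3 m => N0 s1 le_phi le_w.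
(* The step adds at most 8 w + 12 N <= (32 s + 12) N <= 44 s N, as s >= 1; hence the constant 22. *)
have -> : 22 * (s + m%:R^-1) ^+ 2 * (m%:R * N) =
    m%:R * (22 * s ^+ 2 * N) + 44 * s * N + 22 * N / m%:R.
  by field; rewrite gt_eqF.
have : 0 <= 22 * N / m%:R by rewrite divr_ge0 ?mulr_ge0 // ltW.
have : m%:R * phi <= m%:R * (22 * s ^+ 2 * N) by rewrite ler_pM2l.
have : N <= s * N by rewrite ler_peMl.
by lra.
Qed.
End Asymptotics.

(** * Markov's inequality and the conclusion *)

(** At level n + 1 the excess enters the potential with factor 2 n, so each bad cycle either has
    potential at least 2 n or gives an empty graph; [sum_no_vertices] bounds the number of the
    latter by a fraction 1 / n of all cycles. *)
Lemma card_not_connected (n : nat) (A : edges n.+1) : (2 < n)%N ->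
    A \in cycles_upto n.+1 n.+1 ->
  (2 * n * #|[set B in cycles_upto n.+1 n.+1 | ~~ pedigree_connected A B]| <=
    \sum_(B in cycles_upto n.+1 n.+1) potential n.+1 A B +
    2 * #|cycles_upto n.+1 n.+1|)%N.
Proof.
move=> n2 AC; have nn : (2 < n < n.+1)%N by rewrite n2 ltnSn.
have noV := sum_no_vertices AC n2 erefl; rewrite subcycle_of_id in noV.
rewrite [in leqRHS]card_cycles // mulnA.
apply: leq_trans (leq_add (leqnn _) (leq_mul (leqnn (2 * n)) noV)).
rewrite !big_distrr -big_split -sum1_card big_distrr /=.
rewrite [leqLHS]big_mkcond [leqRHS]big_mkcond; apply: leq_sum => B _.
rewrite inE; case: (B \in _) => //=; case: ifP => // /not_connected.
rewrite /potential /=; set V0 := (_ == _); set e := excess _ _ _ => eV.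
have : (2 * n * 1 <= 2 * n * (e + V0))%N by rewrite leq_mul2l eV orbT.
by rewrite mulnDr; lia.
Qed.

Local Open Scope ring_scope.

Theorem theorem3 (R : realType) (eps : R) (eps_gt0 : 0 < eps) :
  exists N : nat, forall n : nat, (N <= n)%N ->
    forall A : {set {set 'I_n.+1}}, A \in cycles n ->
      1 - eps <= uniform_prob R (cycles n) (fun B => pedigree_connected A B).
Proof.
have [N0 small] := harmonic3_sqr_small eps_gt0; exists (maxn N0 3).+1 => -[//|m].
rewrite ltnS geq_max => /andP[N0m m2] A; rewrite cycles_uptoE ?ltnS 1?ltnW // => AC.
set S := cycles_upto _ _; rewrite /uniform_prob.
have m0 : 0 < m%:R :> R by rewrite ltr0n ltnW // ltnW.
have S0 : 0 < #|S|%:R :> R by rewrite ltr0n; apply/card_gt0P; exists A.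
have mle : (2 < m.+1 <= m.+1)%N by rewrite leqnn ltnS ltnW.
have := sum_potential_le R AC mle; rewrite subcycle_of_id -/S.
have := card_not_connected m2 AC; rewrite -/S -(ler_nat R) natrD !natrM.
have cardS : #|S| = (#|[set B in S | pedigree_connected A B]| +
    #|[set B in S | ~~ pedigree_connected A B]|)%N.
  rewrite -(cardsID [set B | pedigree_connected A B] S).
  by congr (_ + _)%N; apply: eq_card => B; rewrite !inE // andbC.
have cardSR := congr1 (fun k => k%:R : R) cardS; rewrite /= natrD in cardSR.
have := small _ N0m; set s := harmonic3 _ _.
set good := (#|_|%:R) in cardSR *; set bad := (#|_|%:R) in cardSR *.
set N := (#|S|%:R) in S0 cardSR *; set phi := (\sum_(_ in _) _)%:R.
move=> s_small badle phile; rewrite ler_pdivlMr // mulrBl mul1r lerBlDr cardSR lerD2l.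
rewrite -(ler_pM2l m0) -cardSR.
(* Halving the Markov bound gives m * bad <= (11 s^2 + 1) N, which is at most eps m N. *)
have := ler_wpM2r (ltW S0) s_small; nra.
Qed.
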